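(* Let $p$ be an odd prime and $\alpha$ an indeterminate over $\mathbb F_p$. For $\gamma\in\{\alpha,-\alpha\}$ let \[ G^{(\gamma)}(X)=-\sum_{k=1}^{p-1}\frac{1}{k}\,\frac{X^{k}}{\prod_{s=1}^{k-1}b_{1,s}(\gamma)}\in\mathbb F_p(\alpha)[X] \] (empty product equal to $1$). Then \[ \prod_{k=1}^{p-1}(1+\alpha/k)^{k}\cdot G^{(\alpha)}(X)=-X^{p}\cdot G^{(-\alpha)}\!\left(\frac{1-\alpha^{p-1}}{X}\right) \] in the polynomial ring $\mathbb F_p(\alpha)[X]$.
   Context: $\mathbb F_p$ is the field of $p$ elements, $\binom{x}{m}=x(x-1)\cdots(x-m+1)/m!$. For integers $0<r,s<p$ (interpreted as elements of $\mathbb F_p$), $b_{r,s}(\alpha)=\sum_{k=0}^{p-1}(-r/s)^k\binom{r\alpha-1}{p-1-k}\binom{s\alpha-1}{k}\in\mathbb F_p[\alpha]$; $b_{1,s}(-\alpha)$ denotes the substitution of $-\alpha$ for $\alpha$. *)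

(* Defs.v *)
From HB Require Import structures.
From mathcomp Require Import all_boot all_order all_algebra fraction.
Set Implicit Arguments. Unset Strict Implicit. Unset Printing Implicit Defensive.
Import Order.TTheory GRing.Theory Num.Theory.
Local Open Scope ring_scope.
Notation "x %:F" := (@FracField.tofrac _ x) : ring_scope.

Definition polbin (p : nat) (x : {poly 'F_p}) (m : nat) : {poly 'F_p} :=
  ((m`!)%:R)^-1 *: \prod_(i < m) (x - (i%:R)%:P).

Definition bpol (p r s : nat) : {poly 'F_p} :=
  \sum_(k < p) ((- (r%:R : 'F_p) / s%:R) ^+ k) *:
     (polbin (r%:R *: 'X - 1) (p.-1 - k) * polbin (s%:R *: 'X - 1) k).

Notation Fpa p := {fraction {poly 'F_p}}.

Definition alphaF (p : nat) : Fpa p := ('X : {poly 'F_p})%:F.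

Definition b1 (p : nat) (neg : bool) (s : nat) : Fpa p :=
  (if neg then bpol p 1 s \Po (- 'X) else bpol p 1 s)%:F.

Definition Gpol (p : nat) (neg : bool) : {poly Fpa p} :=
  - \sum_(1 <= k < p)
      (((k%:R : Fpa p)^-1) / (\prod_(1 <= s < k) b1 p neg s)) *: 'X^k.

(* Main.v *)
(* b_(1,s)(alpha) is the coefficient of x^(p-1) in W = (1 + x)^(alpha-1) (1 - x/s)^(s alpha-1).
   The differential equation of W gives its coefficients a three-term recurrence, whence
   deg b_(1,s) <= (p-1)/2.  Evaluated at a in F_p^*, W is a polynomial in x, of degree < p-1 as soon
   as the residues of a and s a in {1, ..., p-1} have sum < p; this happens for exactly one of a, -a,
   so that these (p-1)/2 zeros and the value 1 at 0 determine b_(1,s).  Two consequences,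
     b_(1,s)(alpha) b_(1,p-1-s)(-alpha) = 1 - alpha^(p-1)   and
     prod_k (1 + alpha/k)^k = (1 - alpha^(p-1)) prod_(s=1)^(p-2) b_(1,s)(alpha),
   give the theorem by comparing coefficients. *)
Require Import Defs.
From HB Require Import structures.
From mathcomp Require Import all_boot all_order all_algebra fraction finfield ring zify.
Import Order.TTheory GRing.Theory Num.Theory.
Local Open Scope ring_scope.

(** * Binomial polynomials, the recurrence and the degree bound *)

Lemma natFp_neq0 {p k : nat} (hp : prime p) : (0 < k < p)%N -> (k%:R : 'F_p) != 0.
Proof.
move=> /andP[k0 kp]; rewrite -(dvdn_pcharf (pchar_Fp hp)).
by apply/negP => /(dvdn_leq k0); rewrite leqNgt kp.
Qed.

Lemma factFp_neq0 {p m : nat} (hp : prime p) : (m < p)%N -> (m`!%:R : 'F_p) != 0.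
Proof.
elim: m => [|m IHm] mp; first by rewrite oner_neq0.
by rewrite factS natrM mulf_neq0 ?IHm ?natFp_neq0 // ltnW.
Qed.

Lemma polbin0 (p : nat) (x : {poly 'F_p}) : polbin x 0 = 1.
Proof. by rewrite /polbin big_ord0 fact0 invr1 scale1r. Qed.

Lemma polbinS {p : nat} (hp : prime p) (x : {poly 'F_p}) (m : nat) : (m.+1 < p)%N ->
  m.+1%:R * polbin x m.+1 = (x - m%:R) * polbin x m.
Proof.
move=> mp; rewrite /polbin big_ord_recr /= -!mul_polyC factS natrM polyC_natr.
rewrite invfM polyCM -[in LHS](polyC_natr _ m.+1) !mulrA -polyCM.
by rewrite mulfV ?natFp_neq0 // mul1r; ring.
Qed.

(* The recurrence is read off from (1 + x)(1 - tx) W' = ((1 - tx) A - t (1 + x) B) W + O(x^N). *)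
Lemma coef_binomial_product {R : comNzRingType} (U V W QU QV : {poly R}) (A B t : R) (N : nat) :
  (1 + 'X) * U^`() = A%:P * U + QU * 'X^N ->
  (1 - t%:P * 'X) * V^`() = - (t * B)%:P * V + QV * 'X^N ->
  W = U * V ->
  ((0 < N)%N -> W`_1 = (A - t * B) * W`_0) /\
  forall n, (n.+1 < N)%N ->
    n.+2%:R * W`_n.+2 = ((t - 1) * n.+1%:R + A - t * B) * W`_n.+1
      + t * (n%:R - A - B) * W`_n.
Proof.
move=> hU hV hW.
pose Q : {poly R} := (1 - t%:P * 'X) * QU * V + (1 + 'X) * U * QV.
have E : W^`() + (1 - t)%:P * (W^`() * 'X) - t%:P * (W^`() * 'X * 'X)
   = (A - t * B)%:P * W - (t * (A + B))%:P * (W * 'X) + Q * 'X^N.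
  transitivity ((1 + 'X) * U^`() * V * (1 - t%:P * 'X)
     + (1 - t%:P * 'X) * V^`() * (U * (1 + 'X))).
    by rewrite hW derivM !rmorphB /= ; ring.
  rewrite hU hV /Q hW !rmorphM rmorphB rmorphM !rmorphD /=; ring.
have {}E i := congr1 (fun P : {poly R} => P`_i) E.
split=> [N0 | n nN].
  move: (E 0%N).
  rewrite !coefD !coefN !coefCM !coefMX coefMXn N0 /= coef_deriv !mulr0 subr0 !addr0.
  by rewrite mulr1n subr0.
move: (E n.+1).
rewrite !coefD !coefN !coefCM !coefMX coefMXn nN /= !coef_deriv.
(* The term [W' x^2] contributes [n * W_n] at x^(n+1); for [n = 0] this is the default 0 of the
   shifted coefficient. *)
case: n nN => [|n] nN /=; rewrite ?coef_deriv => /eqP.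
  rewrite -subr_eq0 => /eqP h; apply/eqP; rewrite -subr_eq0 -[X in _ == X]h.
  by apply/eqP; ring.
rewrite -subr_eq0 => /eqP h; apply/eqP; rewrite -subr_eq0 -[X in _ == X]h.
by apply/eqP; ring.
Qed.

(** [V] is (1 - tx)^B cut off below degree [p], where the factorials are still invertible. The rule
    (j+1) binom(B, j+1) = (B - j) binom(B, j) gives the differential equation of the full power up
    to one term, in degree [p - 1]. *)
Lemma polbin_series_ode {p : nat} (hp : prime p) (t : 'F_p) (B : {poly 'F_p}) :
  let V := \poly_(j < p) ((- t%:P) ^+ j * polbin B j) in
  exists Q, (1 - (t%:P)%:P * 'X) * V^`() = - (t%:P * B)%:P * V + Q * 'X^(p.-1).
Proof.
move=> V.
have p1 : p = p.-1.+1 by rewrite prednK // prime_gt0.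
(* At x^(p-1) the derivative contributes nothing because [V] has no term of degree [p]; what is left
   over there is this constant. *)
exists (- (t%:P * (p.-1%:R - B) * V`_p.-1))%:P.
have Vp j : (p <= j)%N -> V`_j = 0 by move=> pj; rewrite coef_poly ltnNge pj.
have dV j : (V^`() * 'X)`_j = j%:R * V`_j.
  by rewrite coefMX; case: j => [|j] /=; rewrite ?mul0r // coef_deriv mulr_natl.
have -> : (1 - (t%:P)%:P * 'X) * V^`() = V^`() - (t%:P)%:P * (V^`() * 'X) by ring.
apply/polyP => i.
rewrite [LHS]coefB [RHS]coefD mulNr coefN !coefCM dV coefXn coef_deriv -[V`_i.+1 *+ _]mulr_natl.
case: (ltngtP i p.-1) => hi.
- have ip : (i.+1 < p)%N by rewrite p1 ltnS.
  rewrite mulr0 addr0 !coef_poly ip (ltnW ip).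
  transitivity ((- t%:P) ^+ i.+1 * (i.+1%:R * polbin B i.+1)
      - t%:P * (i%:R * ((- t%:P) ^+ i * polbin B i))); first by rewrite exprS; ring.
  by rewrite polbinS // exprS; ring.
- have pi : (p <= i)%N by rewrite p1.
  by rewrite (Vp i) // (Vp i.+1) ?leqW //= !(mulr0, oppr0, addr0).
- rewrite hi -p1 (Vp p) //=; ring.
Qed.

(** In the recurrence the factor of W_(n+1) is constant in alpha and that of W_n is at most linear,
    so the degree grows by at most one every two steps. *)
Lemma size_bpol_leq {p r s : nat} (hp : prime p) : (s%:R : 'F_p) != 0 ->
  (size (bpol p r s) <= p.-1./2.+1)%N.
Proof.
move=> s0; set t : 'F_p := r%:R / s%:R.
have p1 : p = p.-1.+1 by rewrite prednK // prime_gt0.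
set A : {poly 'F_p} := r%:R *: 'X - 1; set B : {poly 'F_p} := s%:R *: 'X - 1.
pose U := \poly_(j < p) ((- (-1)%:P) ^+ j * polbin A j).
pose V := \poly_(j < p) ((- t%:P) ^+ j * polbin B j).
have [QU hU] := polbin_series_ode hp (-1) A.
have [QV hV] := polbin_series_ode hp t B.
have hU1 : (1 + 'X) * U^`() = A%:P * U + QU * 'X^(p.-1).
  by move: hU; rewrite -/U !rmorphN !rmorph1 !mulNr !mul1r rmorphN mulNr !opprK.
have [] := coef_binomial_product _ _ (U * V) _ _ _ _ _ _ hU1 hV erefl.
set W := U * V; move=> W1 Wrec.
have hW : bpol p r s = W`_p.-1.
  rewrite coefMr -p1; apply: eq_bigr => k _.
  have kp : (p.-1 - k < p)%N by rewrite [X in (_ < X)%N]p1 ltnS leq_subr.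
  rewrite !coef_poly ltn_ord kp !rmorphN opprK !rmorph1 expr1n mul1r.
  by rewrite -/A -/B -[_ ^+ k *: _]mul_polyC rmorphXn /= mulNr rmorphN -/t; ring.
have W0 : W`_0 = 1.
  by rewrite coef0M !coef_poly prime_gt0 // !expr0 !polbin0 !mul1r.
(* The choice [t = r / s] makes alpha cancel in [A - t B]. *)
have tA : t%:P * B = r%:R *: 'X - t%:P.
  by rewrite mulrBr mulr1 mul_polyC scalerA mulfVK.
have AtB : A - t%:P * B = (t - 1)%:P by rewrite tA /A polyCB; ring.
clearbody t; suff sW n : (n <= p.-1)%N -> (size (W`_n)%R <= n./2.+1)%N by rewrite hW sW.
elim/ltn_ind: n => -[|[|n]] IHn hn.
- by rewrite W0 size_poly1.
- by rewrite W1 // W0 mulr1 AtB size_polyC_leq1.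
have n2 : (n.+2%:R : 'F_p) != 0 by rewrite natFp_neq0 // p1 ltnS.
rewrite -(size_scale _ n2) -mul_polyC polyC_natr Wrec // -addrA AtB.
pose L : {poly 'F_p} := t%:P * (n%:R - A - B).
have sL : (size L <= 2)%N.
  rewrite /L /A /B -!mul_polyC -!polyC_natr.
  have -> : t%:P * (n%:R%:P - (r%:R%:P * 'X - 1) - (s%:R%:P * 'X - 1)) =
     (t * n.+2%:R)%:P - (t * (r + s)%:R)%:P * 'X :> {poly 'F_p}.
    rewrite !polyCM !polyC_natr; ring.
  rewrite (leq_trans (size_polyD _ _)) // geq_max (leq_trans (size_polyC_leq1 _)) //.
  by rewrite size_polyN mul_polyC (leq_trans (size_scale_leq _ _)) ?size_polyX.
have -> : (t%:P - 1) * n.+1%:R + (t - 1)%:P = ((t - 1) * n.+2%:R)%:P :> {poly 'F_p}.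
  by rewrite polyCM polyCB polyC1 polyC_natr; ring.
rewrite (leq_trans (size_polyD _ _)) // geq_max mul_polyC.
rewrite (leq_trans (size_scale_leq _ _)) /=.
  rewrite (leq_trans (size_polyMleq _ _)) // -/L.
  have /= := leq_add sL (IHn n (ltnW (ltnSn _)) (ltnW (ltnW hn))).
  by case: (_ + _)%N => //= m; rewrite add2n ltnS.
by rewrite (leq_trans (IHn n.+1 _ (ltnW hn))) //; lia.
Qed.

(** * Values and zeros of the polynomials on F_p *)

Lemma horner_polbin {p : nat} (x : {poly 'F_p}) (m : nat) (a : 'F_p) :
  (polbin x m).[a] = (m`!%:R)^-1 * \prod_(i < m) (x.[a] - i%:R).
Proof.
rewrite /polbin hornerZ horner_prod; congr (_ * _).
by apply: eq_bigr => i _; rewrite hornerD hornerN hornerC.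
Qed.

Lemma polbin_root {p : nat} (x : {poly 'F_p}) (m n : nat) (a : 'F_p) :
  x.[a] = n%:R -> (n < m)%N -> (polbin x m).[a] = 0.
Proof.
by move=> xa nm; rewrite horner_polbin (bigD1 (Ordinal nm)) //= xa subrr mul0r mulr0.
Qed.

Lemma polbin_at_neg1 {p : nat} (hp : prime p) (x : {poly 'F_p}) (m : nat) (a : 'F_p) :
  x.[a] = -1 -> (m < p)%N -> (polbin x m).[a] = (-1) ^+ m.
Proof.
move=> xa mp; rewrite horner_polbin xa.
have -> : \prod_(i < m) (-1 - i%:R) = (-1) ^+ m * m`!%:R :> 'F_p.
  elim: m {mp} => [|m IHm]; first by rewrite big_ord0 mulr1.
  by rewrite big_ord_recr IHm factS natrM exprS /=; ring.
by rewrite mulrC mulfK // factFp_neq0.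
Qed.

(** At 0 both binomials are taken at -1, and their signs multiply to (-1)^(p-1) = 1. A geometric sum
    in t = -r/s remains; it equals (t^p - 1)/(t - 1) = 1 by Fermat, with t different from 1 since r
    + s is nonzero. *)
Lemma bpol_at0 {p r s : nat} (hp : prime p) (hodd : odd p) :
  (s%:R : 'F_p) != 0 -> ((r + s)%:R : 'F_p) != 0 -> (bpol p r s).[0] = 1.
Proof.
move=> s0 rs0; have p0 := prime_gt0 hp.
rewrite /bpol horner_sum; set t : 'F_p := - r%:R / s%:R.
have x0 (n : nat) : (n%:R *: 'X - 1 : {poly 'F_p}).[0] = -1.
  by rewrite hornerD hornerZ hornerX mulr0 hornerN hornerC add0r.
transitivity (\sum_(k < p) t ^+ k).
  apply: eq_bigr => k _; rewrite hornerZ hornerM !(polbin_at_neg1 hp) //; last first.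
    by rewrite (leq_ltn_trans (leq_subr _ _)) // prednK.
  rewrite -exprD subnK; last by rewrite -ltnS prednK.
  rewrite -[(-1) ^+ _]signr_odd.
  have -> : odd p.-1 = false by move: hodd; rewrite -{1}(prednK p0) /= => /negPf.
  by rewrite mulr1.
have t1 : t - 1 != 0.
  have -> : t - 1 = - (r + s)%:R / s%:R by rewrite /t natrD; field.
  by rewrite mulf_neq0 ?invr_eq0 ?oppr_eq0.
apply: (mulfI t1); rewrite -subrX1 mulr1; congr (_ - _).
by rewrite -[RHS](expf_card t) card_Fp.
Qed.

Lemma lt_Fp {p : nat} (hp : prime p) (a : 'F_p) : (a < p)%N.
Proof. by rewrite -[X in (_ < X)%N](Fp_cast hp) ltn_ord. Qed.

Lemma gt0_Fp {p : nat} (a : 'F_p) : (0 < a)%N = (a != 0).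
Proof. by rewrite lt0n. Qed.

Lemma val_add_Fp {p : nat} (hp : prime p) (a b : 'F_p) : (a + b : 'F_p) = ((a + b) %% p)%N :> nat.
Proof. by rewrite -(val_Fp_nat hp) natrD !natr_Zp. Qed.

Lemma val_opp_Fp {p : nat} (hp : prime p) (a : 'F_p) : a != 0 -> (- a : 'F_p) = (p - a)%N :> nat.
Proof.
move=> a0; have ap := lt_Fp hp a.
have h : ((- a : 'F_p) + a)%N = 0 %[mod p] by rewrite -(val_add_Fp hp) addNr mod0n.
have := lt_Fp hp (- a); have : (- a : 'F_p) != 0 by rewrite oppr_eq0.
move: a0 h; rewrite -!gt0_Fp; move: (nat_of_ord (- a)) (nat_of_ord a) ap => x y; rewrite mod0n.
move=> yp y0 /eqP/dvdnP[[|[|q]] hq] x0 xp; rewrite ?mul0n ?mul1n in hq; [lia|lia|].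
have := leq_mul2r p 2 q.+2; rewrite -hq orbT; lia.
Qed.

Lemma big_Fp {R : Type} {idx : R} {op : R -> R -> R} {p : nat} (hp : prime p) (F : 'F_p -> R) :
  \big[op/idx]_(x : 'F_p) F x = \big[op/idx]_(0 <= i < p) F i%:R.
Proof.
rewrite -[X in \big[_/_]_(_ <= _ < X) _](Fp_cast hp) big_mkord.
by apply: eq_bigr => i _; rewrite natr_Zp.
Qed.

(* The outer addition is in [nat]: it adds the representatives of [a] and [s a] in {1, ..., p - 1}. *)
Definition bpol_zero (p s : nat) (a : 'F_p) : bool :=
  (a != 0) && (a + (s%:R * a : 'F_p)%R < p)%N.

(** Let x and y represent a and s a. A nonzero k-th term would need p-1-k <= x-1 and k <= y-1, hence
    x + y > p. *)
Lemma bpol_zeroP {p s : nat} (hp : prime p) (a : 'F_p) :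
  (s%:R : 'F_p) != 0 -> bpol_zero p s a -> (bpol p 1 s).[a] = 0.
Proof.
move=> s0 /andP[a0 lt_p]; rewrite /bpol horner_sum big1 // => k _.
rewrite hornerZ hornerM.
have pred_eval (n : nat) : n%:R * a != 0 ->
    (n%:R *: 'X - 1 : {poly 'F_p}).[a] = ((n%:R * a : 'F_p)%R : nat).-1%:R.
  move=> na0; rewrite hornerD hornerZ hornerX hornerN hornerC.
  move: na0; set b : 'F_p := n%:R * a => b0.
  by rewrite -[b in LHS]natr_Zp -[in LHS](@prednK b) ?gt0_Fp // -natr1 addrK.
have sa0 : s%:R * a != 0 by rewrite mulf_neq0.
have h1 : (1 : {poly 'F_p}).[a] = 1 by rewrite hornerC.
case: (ltnP (s%:R * a : 'F_p)%R.-1 k) => hk.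
  by rewrite (polbin_root _ _ _ _ (pred_eval s sa0) hk) !mulr0.
rewrite (polbin_root _ _ _ _ (pred_eval 1%N _)) ?mul1r ?mul0r ?mulr0 //.
have := sa0; have := a0; rewrite -!gt0_Fp; move: lt_p hk; have := prime_gt0 hp; lia.
Qed.

(** Negation replaces the sum x + y of representatives by 2p - (x + y), and x + y = p is excluded
    because (1 + s) a is nonzero. *)
Lemma bpol_zero_opp {p s : nat} (hp : prime p) (a : 'F_p) :
  (s.+1 < p)%N -> (0 < s)%N -> a != 0 -> bpol_zero p s (- a) = ~~ bpol_zero p s a.
Proof.
move=> sp s0 a0; rewrite /bpol_zero oppr_eq0 a0 mulrN !andTb.
have s0' : (s%:R : 'F_p) != 0 by rewrite natFp_neq0 // s0 ltnW.
have sa0 : s%:R * a != 0 by rewrite mulf_neq0.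
have : a + s%:R * a != 0.
  by rewrite -{1}[a]mul1r -mulrDl mulf_neq0 // nat1r natFp_neq0.
rewrite -gt0_Fp (val_add_Fp hp). rewrite !(val_opp_Fp hp) //.
move: (lt_Fp hp a) (lt_Fp hp (s%:R * a)) a0 sa0; rewrite -!gt0_Fp.
move: (nat_of_ord (s%:R * a)) (nat_of_ord a) => y x xp yp x0 y0.
case: (ltngtP (x + y)%N p) => [h _|h _|->]; last by rewrite modnn.
all: lia.
Qed.

Lemma card_bpol_zero {p s : nat} (hp : prime p) : (0 < s)%N -> (s.+1 < p)%N ->
  (#|bpol_zero p s|.*2 = p.-1)%N.
Proof.
have card_sum (P : pred 'F_p) : #|P| = (\sum_a P a)%N.
  by rewrite -sum1_card big_mkcond; apply: eq_bigr => a _; rewrite unfold_in; case: (P a).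
move=> s0 sp; rewrite -addnn {1}card_sum (reindex_inj oppr_inj) card_sum -big_split /=.
transitivity #|predC1 (0 : 'F_p)|; last by rewrite cardC1 card_Fp.
rewrite card_sum; apply: eq_bigr => a _ /=; case: (eqVneq a 0) => [->|a0].
  by rewrite oppr0 /bpol_zero eqxx.
by rewrite bpol_zero_opp //; case: bpol_zero.
Qed.

(** * Linear factorization and the reflection identity *)

Lemma poly_eq_on {F : idomainType} (P Q : {poly F}) (rs : seq F) :
  uniq rs -> (size P <= size rs)%N -> (size Q <= size rs)%N ->
  {in rs, forall x, P.[x] = Q.[x]} -> P = Q.
Proof.
move=> urs sP sQ PQ; apply/eqP; rewrite -subr_eq0; apply/eqP.
apply: (roots_geq_poly_eq0 _ urs).
  by apply/allP => x /PQ PQx; rewrite rootE !hornerE PQx subrr.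
by rewrite (leq_trans (size_polyD _ _)) // geq_max sP size_polyN.
Qed.

Lemma size_prod_linear {F : fieldType} {I : finType} (P : pred I) (f : I -> F) :
  (size (\prod_(i | P i) (1 - f i *: 'X : {poly F}))%R <= #|P|.+1)%N.
Proof.
rewrite (leq_trans (size_poly_prod_leq _ _)) // leq_subLR addnS ltnS addnn -muln2 -sum_nat_const.
apply: leq_sum => i _; rewrite (leq_trans (size_polyD _ _)) // geq_max size_poly1.
by rewrite size_polyN (leq_trans (size_scale_leq _ _)) ?size_polyX.
Qed.

Lemma horner_prod_linear0 {F : fieldType} {I : finType} (P : pred I) (f : I -> F) :
  (\prod_(i | P i) (1 - f i *: 'X : {poly F})).[0] = 1.
Proof.
rewrite horner_prod big1 // => i _.
by rewrite hornerD hornerN hornerZ hornerX hornerC mulr0 subr0.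
Qed.

Lemma horner_prod_linear_root {F : finFieldType} (P : pred F) (a : F) : P a -> a != 0 ->
  (\prod_(i | P i) (1 - i^-1 *: 'X : {poly F})).[a] = 0.
Proof.
move=> Pa a0; rewrite horner_prod (bigD1 a) //=.
by rewrite hornerD hornerN hornerZ hornerX hornerC mulVf // subrr mul0r.
Qed.

(** Both sides have degree at most (p-1)/2 and agree at the (p-1)/2 known zeros and at 0. *)
Lemma bpol_factor {p s : nat} (hp : prime p) (hodd : odd p) : (0 < s)%N -> (s.+1 < p)%N ->
  bpol p 1 s = \prod_(a | bpol_zero p s a) (1 - a^-1 *: 'X).
Proof.
move=> s0 sp; have s0' : (s%:R : 'F_p) != 0 by rewrite natFp_neq0 // s0 ltnW.
have Hc : size (enum (bpol_zero p s)) = p.-1./2.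
  by rewrite -cardE -(card_bpol_zero hp s0 sp) doubleK.
apply: (poly_eq_on _ _ (0 :: enum (bpol_zero p s))).
- by rewrite /= enum_uniq mem_enum unfold_in /bpol_zero eqxx.
- by rewrite /= Hc size_bpol_leq.
- by rewrite /= -cardE size_prod_linear.
move=> a; rewrite inE => /orP[/eqP->|].
  by rewrite bpol_at0 ?horner_prod_linear0 // add1n natFp_neq0.
rewrite mem_enum => Za; have /andP[a0 _] := Za.
by rewrite bpol_zeroP // horner_prod_linear_root.
Qed.

Lemma prod_linear_Fp {p : nat} (hp : prime p) :
  \prod_(a : 'F_p | a != 0) (1 - a^-1 *: 'X) = 1 - 'X ^+ p.-1 :> {poly 'F_p}.
Proof.
have p0 := prime_gt0 hp.
have p1 : (0 < p.-1)%N by rewrite -ltnS prednK // prime_gt1.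
have sz : size (enum 'F_p) = p by rewrite -cardE card_Fp.
apply: (poly_eq_on _ _ (enum 'F_p)); rewrite ?enum_uniq ?sz //.
- by rewrite (leq_trans (size_prod_linear _ _)) // cardC1 card_Fp // prednK.
- by rewrite (leq_trans (size_polyD _ _)) // geq_max size_poly1 p0 size_polyN size_polyXn prednK /=.
move=> a _; rewrite hornerD hornerN hornerXn hornerC.
case: (eqVneq a 0) => [->|a0].
  by rewrite horner_prod_linear0 expr0n eqn0Ngt p1 subr0.
rewrite horner_prod_linear_root //.
suff -> : a ^+ p.-1 = 1 by rewrite subrr.
by apply: (mulfI a0); rewrite -exprS prednK // mulr1 -[in RHS](expf_card a) card_Fp.
Qed.

(** The zeros of the second factor are exactly the nonzero a that are not zeros of the first, so
    together the linear factors run once over F_p^*. *)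
Lemma bpol_reflection {p s : nat} (hp : prime p) (hodd : odd p) :
  (0 < s)%N -> (s.+1 < p)%N ->
  bpol p 1 s * (bpol p 1 (p.-1 - s) \Po (- 'X)) = 1 - 'X ^+ p.-1.
Proof.
move=> s0 sp; have p0 := prime_gt0 hp.
rewrite !bpol_factor //; try lia.
rewrite rmorph_prod /= -(prod_linear_Fp hp) [RHS](bigID (bpol_zero p s)) /=.
congr (_ * _); last rewrite (reindex_inj oppr_inj) /=; apply: eq_big => // a.
- by rewrite /bpol_zero andbA andbb.
- have s0' : (s%:R : 'F_p) != 0 by rewrite natFp_neq0 // s0 ltnW.
  rewrite /bpol_zero oppr_eq0; case: eqVneq => // a0; rewrite !andTb.
  (* The zero condition for -a and p-1-s thus compares (p - x) + ((x + y) mod p) with p; it holds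
     exactly when x + y >= p. *)
  have -> : (p.-1 - s)%:R * - a = a + s%:R * a.
    have -> : (p.-1 - s)%:R = - 1 - s%:R :> 'F_p.
      rewrite -subn1 !natrB ?pchar_Fp_0 ?sub0r //; lia.
    by ring.
  rewrite (val_opp_Fp hp) // (val_add_Fp hp).
  move: (lt_Fp hp a) (lt_Fp hp (s%:R * a)) a0; rewrite -!gt0_Fp.
  move: (nat_of_ord (s%:R * a)) (nat_of_ord a) => y x xp yp x0.
  case: (ltngtP (x + y)%N p) => [h|h|->]; last by rewrite modnn; lia.
    by rewrite modn_small //; lia.
  have -> : ((x + y) %% p = x + y - p)%N.
    by rewrite -[in LHS](subnK (ltnW h)) modnDr modn_small //; lia.
  lia.
- move=> _; rewrite comp_polyB comp_polyZ comp_polyX comp_polyC invrN scaleNr scalerN opprK.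
  by [].
Qed.

(** * Multiplicities of the linear factors and the product formulas *)

(** The successor is the term s = 0, which always counts, while s = p-1 never does. With both added,
    s a runs over all of F_p, and the x with a + x < p number p - a. *)
Lemma sum_bpol_zero {p : nat} (hp : prime p) (a : 'F_p) : a != 0 ->
  (\sum_(1 <= s < p.-1) bpol_zero p s a).+1 = (p - a)%N.
Proof.
move=> a0; have p1 := prime_gt1 hp; have ap := lt_Fp hp a.
have a0n : (0 < a)%N by rewrite gt0_Fp.
transitivity (\sum_(0 <= s < p) bpol_zero p s a)%N.
  rewrite [RHS]big_ltn; last by lia.
  rewrite [index_iota 1 p](_ : _ = index_iota 1 p.-1.+1); last by rewrite prednK ?(ltnW p1).
  rewrite big_nat_recr /=; last by lia.
  have -> : bpol_zero p 0 a = true by rewrite /bpol_zero a0 mulr0n mul0r addn0.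
  have -> : bpol_zero p p.-1 a = false; last by rewrite addn0 add1n.
  rewrite /bpol_zero a0 andTb -subn1 natrB ?(ltnW p1) // pchar_Fp_0 // sub0r mulN1r.
  by rewrite (val_opp_Fp hp) // subnKC ?ltnn // ltnW.
rewrite -(big_Fp hp (fun x => nat_of_bool ((a != 0) && (a + (x * a : 'F_p)%R < p)%N))).
rewrite (reindex_inj (mulIf (invr_neq0 a0))).
transitivity (\sum_(x : 'F_p) (a + x < p))%N.
  by apply: eq_bigr => x _; rewrite mulfVK // a0.
rewrite (big_Fp hp (fun x => nat_of_bool (a + x < p)%N)).
transitivity (\sum_(0 <= i < p - a) 1)%N; last by rewrite sum_nat_const_nat subn0 muln1.
rewrite (big_nat_widen _ (p - a) p) ?leq_subr // [RHS]big_mkcond; apply: eq_big_nat => i /andP[_ ip].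
by rewrite val_Fp_nat // modn_small // ltn_subRL; case: (_ < _)%N.
Qed.

(** Compare multiplicities of 1 - alpha/a: on the left p - a, from k = p - a; on the right one from
    1 - alpha^(p-1) and one for each s having a as a zero. *)
Lemma prod_bpol {p : nat} (hp : prime p) (hodd : odd p) :
  \prod_(1 <= k < p) (1 + (k%:R : 'F_p)^-1 *: 'X) ^+ k =
  (1 - 'X ^+ p.-1) * \prod_(1 <= s < p.-1) bpol p 1 s.
Proof.
pose f (a : 'F_p) : {poly 'F_p} := 1 - a^-1 *: 'X.
transitivity (\prod_(a : 'F_p | a != 0) f a ^+ (p - a)).
  transitivity (\prod_(a : 'F_p) if a != 0 then f (- a) ^+ a else 1).
    rewrite (big_Fp hp) [RHS]big_ltn ?prime_gt0 // eqxx mul1r.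
    apply: eq_big_nat => k k0p; rewrite natFp_neq0 // val_Fp_nat // modn_small.
      by rewrite /f invrN scaleNr opprK.
    by case/andP: k0p.
  rewrite [RHS]big_mkcond [RHS](reindex_inj oppr_inj); apply: eq_bigr => a _.
  rewrite oppr_eq0; case: eqVneq => // a0.
  by rewrite (val_opp_Fp hp) // subKn // ltnW // lt_Fp.
have -> : \prod_(1 <= s < p.-1) bpol p 1 s =
    \prod_(1 <= s < p.-1) \prod_(a : 'F_p | a != 0) f a ^+ bpol_zero p s a.
  apply: eq_big_nat => s /andP[s0 sp]; rewrite bpol_factor //; last by lia.
  rewrite big_mkcond [RHS]big_mkcond; apply: eq_bigr => a _.
  by rewrite /bpol_zero; case: (a != 0); case: (_ < _)%N.
rewrite exchange_big -(prod_linear_Fp hp) -big_split /=; apply: eq_bigr => a a0.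
by rewrite prodrXr -exprS (sum_bpol_zero hp).
Qed.

(** Split the product formula at s = k. The p-1-k factors with s >= k pair with the
    b_(1,p-1-s)(-alpha), each pair giving 1 - alpha^(p-1); one more such factor is already
    present. *)
Lemma prod_bpol_reflection {p k : nat} (hp : prime p) (hodd : odd p) : (0 < k < p)%N ->
  (\prod_(1 <= j < p) (1 + (j%:R : 'F_p)^-1 *: 'X) ^+ j) *
    \prod_(1 <= s < p - k) (bpol p 1 s \Po (- 'X)) =
  (1 - 'X ^+ p.-1) ^+ (p - k) * \prod_(1 <= s < k) bpol p 1 s.
Proof.
move=> /andP[k0 kp].
have shift : \prod_(1 <= s < p - k) (bpol p 1 s \Po (- 'X)) =
    \prod_(k <= s < p.-1) (bpol p 1 (p.-1 - s) \Po (- 'X)).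
  have := big_addn 1 p.-1 k.-1 predT (fun s => bpol p 1 (p.-1 - s) \Po (- 'X)).
  rewrite add1n prednK // => ->; have -> : (p.-1 - k.-1 = p - k)%N by lia.
  rewrite big_nat_rev; apply: eq_big_nat => s s_lt.
  by congr (bpol p 1 _ \Po _); lia.
have E : \prod_(k <= s < p.-1) bpol p 1 s * \prod_(1 <= s < p - k) (bpol p 1 s \Po (- 'X)) =
    (1 - 'X ^+ p.-1) ^+ (p.-1 - k).
  rewrite shift -big_split /= -prodr_const_nat; apply: eq_big_nat => s /andP[ks sp].
  by rewrite bpol_reflection //; lia.
rewrite prod_bpol // (@big_cat_nat _ _ _ k) /=; try lia.
move: E; have -> : (p - k = (p.-1 - k).+1)%N by lia.
by move=> E; rewrite exprS -E; ring.
Qed.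

(** * Comparison of coefficients over F_p(alpha) *)

Lemma tofrac_polyC_natV {p k : nat} (hp : prime p) : (0 < k < p)%N ->
  (((k%:R : 'F_p)^-1)%:P)%:F = (k%:R : Fpa p)^-1.
Proof.
move=> kp; have k0 := natFp_neq0 hp kp.
have e : ((k%:R : 'F_p)%:P)%:F = k%:R :> Fpa p by rewrite polyC_natr rmorph_nat.
have k0' : (k%:R : Fpa p) != 0 by rewrite -e tofrac_eq0 polyC_eq0.
by apply: (mulfI k0'); rewrite mulfV // -{1}e -tofracM -polyCM mulfV.
Qed.

Lemma b1_neq0 {p s : nat} (neg : bool) (hp : prime p) (hodd : odd p) :
  (0 < s)%N -> (s.+1 < p)%N -> b1 p neg s != 0.
Proof.
move=> s0 sp; have h0 : (bpol p 1 s).[0] = 1.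
  by rewrite bpol_at0 ?add1n ?natFp_neq0 // s0 ltnW.
rewrite /b1 tofrac_eq0; apply/eqP => b0.
have : (if neg then bpol p 1 s \Po - 'X else bpol p 1 s).[0] = 1.
  by case: neg {b0} => //; rewrite horner_comp hornerN hornerX oppr0.
by rewrite b0 horner0 => /esym/eqP; rewrite oner_eq0.
Qed.

(** Turns the product identity into the coefficient identity; [- k] stands for p - k in
    characteristic p. *)
Lemma cross_ratio_eq {F : fieldType} {P C B B' : F} (k : F) :
  B != 0 -> B' != 0 -> P * B' = C * B -> P * (k^-1 / B) = - ((- k)^-1 / B' * C).
Proof.
move=> B0 B0' e; rewrite invrN !mulNr opprK mulrCA -!mulrA; congr (_ * _).
by rewrite [RHS]mulrC; apply/eqP; rewrite eqr_div // e.
Qed.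

Lemma coef_Gpol_reflection {p k : nat} (hp : prime p) (hodd : odd p) : (0 < k < p)%N ->
  let a := alphaF p in
  let P := \prod_(1 <= j < p) (1 + a / j%:R) ^+ j in
  P * ((k%:R)^-1 / \prod_(1 <= s < k) b1 p false s) =
  - ((((p - k)%:R)^-1 / \prod_(1 <= s < p - k) b1 p true s) * (1 - a ^+ p.-1) ^+ (p - k)).
Proof.
move=> kp a P; have /andP[k0 kltp] := kp.
have b0 neg m : (m < p)%N -> \prod_(1 <= s < m) b1 p neg s != 0.
  move=> mp; rewrite prodf_seq_neq0; apply/allP => s; rewrite mem_index_iota => /andP[s0 sm].
  by rewrite b1_neq0 // (leq_ltn_trans sm).
have bk := b0 false k kltp; have bpk : \prod_(1 <= s < p - k) b1 p true s != 0.
  by rewrite b0 //; lia.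
have p0 : p%:R = 0 :> Fpa p.
  by rewrite -(rmorph_nat (@FracField.tofrac {poly 'F_p})) -polyC_natr pchar_Fp_0 // polyC0 tofrac0.
have -> : ((p - k)%:R : Fpa p) = - k%:R by rewrite natrB ?p0 ?sub0r // ltnW.
have key : P * \prod_(1 <= s < p - k) b1 p true s =
    (1 - a ^+ p.-1) ^+ (p - k) * \prod_(1 <= s < k) b1 p false s.
  have := congr1 (@FracField.tofrac _) (prod_bpol_reflection hp hodd kp).
  rewrite !tofracM tofracXn tofracB tofracXn tofrac1 -!rmorph_prod /= => <-; congr (_ * _).
  rewrite rmorph_prod; apply: eq_big_nat => j jp /=.
  rewrite rmorphXn rmorphD rmorph1 /= -mul_polyC rmorphM /= tofrac_polyC_natV //.
  by rewrite mulrC.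
exact: (cross_ratio_eq _ bk bpk key).
Qed.

(** Since X^p (c/X)^(p-k) = c^(p-k) X^k, the substitution matches the coefficient at k with the one
    at p - k. *)
Lemma tofrac_reciprocal {K : fieldType} {p : nat} (u v : nat -> K) (c : K) :
  (forall k, (0 < k < p)%N -> u k = - (v (p - k)%N * c ^+ (p - k))) ->
  (\sum_(1 <= k < p) u k *: 'X^k : {poly K})%:F =
  - ('X ^+ p)%:F * (map_poly (fun w : K => (w%:P)%:F)
      (\sum_(1 <= k < p) v k *: 'X^k)).[(c%:P)%:F / ('X)%:F] :> {fraction {poly K}}.
Proof.
have cancel (F : fieldType) (w d x y : F) : y != 0 -> - (w * d) * x = - (x * y) * (w * (d / y)).
  by move=> y0; field.
move=> uv; have X0 : ('X : {poly K})%:F != 0 by rewrite tofrac_eq0 polyX_eq0.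
rewrite -[map_poly _ _]/(map_poly (@FracField.tofrac {poly K} \o polyC) _).
rewrite [in RHS]rmorph_sum horner_sum mulr_sumr rmorph_sum /=.
rewrite [RHS]big_nat_rev /=; apply: eq_big_nat => k kp.
have /andP[_ /ltnW k_le_p] := kp.
rewrite add1n subSS uv // -mul_polyC map_polyZ map_polyXn hornerZ hornerXn /=.
rewrite polyCN polyCM polyC_exp !(tofracM, tofracN, tofracXn) expr_div_n.
(* Splitting X^p this way lets X^(p-k) cancel against the denominator of (c/X)^(p-k). *)
have -> (x : {fraction {poly K}}) : x ^+ p = x ^+ k * x ^+ (p - k) by rewrite -exprD subnKC.
by apply: cancel; rewrite expf_neq0.
Qed.

(* Identity in F_p(alpha)[X], checked inside its fraction field F_p(alpha)(X)
   (needed to make sense of the substitution X -> (1 - alpha^(p-1))/X). *)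
Theorem theorem6 (p : nat) (hp : prime p) (hodd : odd p) :
  let a := alphaF p in
  let c : Fpa p := 1 - a ^+ p.-1 in
  (((\prod_(1 <= k < p) (1 + a / k%:R) ^+ k) *: Gpol p false)%:F
    : {fraction {poly Fpa p}})
  = - ('X ^+ p)%:F *
      (map_poly (fun u : Fpa p => (u%:P)%:F) (Gpol p true)).[(c%:P)%:F / ('X)%:F].
Proof.
move=> a c.
have GE neg : Gpol p neg =
    \sum_(1 <= k < p) - (k%:R^-1 / \prod_(1 <= s < k) b1 p neg s) *: 'X^k.
  by rewrite /Gpol -sumrN; apply: eq_bigr => k _; rewrite scaleNr.
rewrite !GE; set P := (P in P *: _); rewrite scaler_sumr.
under eq_bigr do rewrite scalerA.
apply: tofrac_reciprocal => k kp.
by rewrite mulrN coef_Gpol_reflection // mulNr.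
Qed.
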